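(* Let $K$ be the attractor of the system $\mathcal{S}=\{S_0,S_1,S_2,S_3\}$ corresponding to admissible parameters $p_1,p_2,p_3,B_1,B_2,B_3$. Let $O$ be the fixed point of $S_0$, let $\gamma_1\subset K$ be the arc in $K$ with endpoints $O$ and $A_1$, and let $s=\dim_H(\gamma_1)$. Let $CP(K)$ be the set of cut points of $K$. Then $\dim_H CP(K)=s$.
   Context: Identify $\mathbb{R}^2$ with $\mathbb{C}$. Let $\Delta$ be the (closed, filled) triangle with vertices $A_1=0$, $A_2=1$, $A_3=e^{i\pi/3}=(1/2,\sqrt3/2)$. For positive numbers $p_1,p_2,p_3$ with $p_1+p_2+p_3<1$ put $S_1(z)=p_1z$, $S_2(z)=p_2z-p_2+1$, $S_3(z)=p_3z-p_3e^{i\pi/3}+e^{i\pi/3}$ (contracting similarities fixing $A_1,A_2,A_3$ respectively), and write $S_{ij}=S_i\circ S_j$. Let $K'$ be the attractor of $\{S_1,S_2,S_3\}$, i.e. the unique nonempty compact set with $K'=S_1(K')\cup S_2(K')\cup S_3(K')$. The parameters $p_1,p_2,p_3,B_1,B_2,B_3$ are called admissible if $p_1,p_2,p_3>0$, $p_1+p_2+p_3<1$, and $B_1,B_2,B_3$ are the vertices of an equilateral triangle with $$B_1\in K'\cap S_{12}([A_2A_3]),\quad B_2\in K'\cap S_{23}([A_1A_3]),\quad B_3\in K'\cap S_{31}([A_1A_2]),$$ where $[A_iA_j]$ denotes the closed side of $\Delta$ joining $A_i$ and $A_j$. For admissible parameters, $S_0$ is the similarity of the plane with $S_0(A_k)=B_k$,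 $k=1,2,3$. The attractor $K$ of $\mathcal{S}$ is the unique nonempty compact set with $K=\bigcup_{i=0}^3S_i(K)$. It is a dendrite, so any two distinct points of $K$ are joined by a unique arc in $K$. A cut point of $K$ is a point $x\in K$ such that $K\setminus\{x\}$ is disconnected. $\dim_H$ denotes Hausdorff dimension. *)

(* Defs.v *)
From HB Require Import structures.
From mathcomp Require Import all_boot all_order all_algebra.
From mathcomp Require Import all_classical all_reals all_analysis.
Set Implicit Arguments.
Unset Strict Implicit.
Unset Printing Implicit Defensive.
Import Order.TTheory GRing.Theory Num.Theory.
Import numFieldNormedType.Exports.
Local Open Scope classical_set_scope.
Local Open Scope ring_scope.

(* MathComp-Analysis: the plane is R * R for R : realType, with its product
   topology. The norm `|_| of the library on R * R is the sup norm; all metric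
   notions below use the Euclidean distance instead. *)

Section Plane.
Variable R : realType.
Implicit Types (x y a b : R * R) (A U K : set (R * R)).

Definition eucl_dist x y : R :=
  Num.sqrt ((x.1 - y.1) ^+ 2 + (x.2 - y.2) ^+ 2).

(* The diameter of the empty set is -oo here; [diam_pow] handles it apart. *)
Definition eucl_diam U : \bar R :=
  ereal_sup [set (eucl_dist z.1 z.2)%:E | z in U `*` U].

(* diam(U)^s, with 0 for the empty set even when s = 0, and 0^0 = 1 for a
   singleton, so that the 0-dimensional measure counts points. *)
Definition diam_pow (s : R) U : \bar R :=
  if U == set0 then 0%E else poweR (eucl_diam U) s.

(* Covers are sequences; finite ones are those with U n = set0 eventually. *)
Definition hausdorff_premeasure (s delta : R) A : \bar R :=
  ereal_inf [set (\sum_(0 <= n <oo) diam_pow s (U n))%E | U in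
    [set U : nat -> set (R * R) |
      A `<=` \bigcup_n U n /\ forall n, (eucl_diam (U n) <= delta%:E)%E]].

(* The premeasure is nonincreasing in delta, so this supremum is its limit as
   delta tends to 0 from above. *)
Definition hausdorff_measure (s : R) A : \bar R :=
  ereal_sup [set hausdorff_premeasure s delta A | delta in
    [set delta : R | 0 < delta]].

Definition hausdorff_dim A : \bar R :=
  ereal_inf [set s%:E | s in
    [set s : R | 0 <= s /\ hausdorff_measure s A = 0%E]].

Definition is_arc (gamma : set (R * R)) a b : Prop :=
  exists f : R -> R * R,
    [/\ {within `[0, 1], continuous f},
        set_inj `[0, 1] f,
        f 0 = a, f 1 = b & gamma = f @` `[0, 1]].

Definition cut_points K : set (R * R) :=
  [set x | K x /\ ~ connected (K `\ x)].

Definition is_attractor (F : set (R * R -> R * R)) K : Prop :=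
  [/\ K !=set0, compact K & K = \bigcup_(f in F) (f @` K)].

Definition is_similarity (f : R * R -> R * R) : Prop :=
  exists2 r : R, 0 < r & forall x y, eucl_dist (f x) (f y) = r * eucl_dist x y.

Definition side a b : set (R * R) :=
  [set (1 - t) *: a + t *: b | t in `[0, 1]].

Definition equilateral a b c : Prop :=
  [/\ a <> b, eucl_dist a b = eucl_dist b c & eucl_dist b c = eucl_dist c a].

Definition A1 : R * R := (0, 0).
Definition A2 : R * R := (1, 0).
Definition A3 : R * R := (1 / 2, Num.sqrt 3 / 2).

Definition S1 (p1 : R) (z : R * R) : R * R := p1 *: z.
Definition S2 (p2 : R) (z : R * R) : R * R := p2 *: z - p2 *: A2 + A2.
Definition S3 (p3 : R) (z : R * R) : R * R := p3 *: z - p3 *: A3 + A3.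

(* K' is the attractor of S1, S2, S3, which enters the condition on the Bi. *)
Definition admissible (p1 p2 p3 : R) (B1 B2 B3 : R * R) : Prop :=
  [/\ 0 < p1, 0 < p2, 0 < p3 & p1 + p2 + p3 < 1] /\
  equilateral B1 B2 B3 /\
  exists2 K' : set (R * R),
    is_attractor [set S1 p1; S2 p2; S3 p3] K' &
    [/\ (K' `&` (S1 p1 \o S2 p2) @` side A2 A3) B1,
        (K' `&` (S2 p2 \o S3 p3) @` side A1 A3) B2 &
        (K' `&` (S3 p3 \o S1 p1) @` side A1 A2) B3].

End Plane.

Arguments A1 {R}.
Arguments A2 {R}.
Arguments A3 {R}.

(* Main.v *)
(* Write f_0, ..., f_3 for S0, ..., S3. In barycentric coordinates f_a K lies
   in {lambda_a >= 1 - p_a}, so the three cells f_a K (a = 1, 2, 3) are pairwise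
   disjoint, and f_0 K meets f_a K in the single point B_a = f_0 A_a = f_a c_a
   with c_a in f_(a+1) K. Hence K retracts onto each f_i K, and composing with
   f_i^-1 gives continuous maps phi_i : K -> K. If C is a connected subset of K
   that meets f_i K, then f_i (phi_i C) is contained in C.

   Upper bound. Let s = dim gamma_1. From a connected C containing O and A_a, the
   set phi_a C contains c_a and A_a, phi_0 (phi_a C) contains A_a and A_(a+1),
   and O is in the closure of both; so connected sets of dimension at most s
   join O to every A_a and to every c_a. The images of these sets under f_0 and
   the f_a form a connected hub containing O and all f_i O, and the images of the
   hub under all words in the f_i form a connected dense subset T of K, of
   dimension at most s. If x is not in T, then K minus x lies between T and its
   closure, hence is connected; so all cut points are in T.

   Lower bound. Let x be an interior point of gamma_1 that is not one of the
   countably many points f_w B_a, and let i_0 i_1 ... be its address. For y <> x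
   in K, Phi_n = phi_(i_(n-1)) o ... o phi_(i_0) is locally constant near y for
   large n, so "Phi_n y = Phi_n O for some n" defines a clopen subset of K minus
   x. If K minus x were connected this would give Phi_n O = Phi_n A_1; but the
   two halves of gamma_1 meet only in x, which forces Phi_n O = Phi_n x, and then
   x is some f_w B_a. *)
Require Import Defs.
From mathcomp Require Import all_boot all_order all_algebra.
From mathcomp Require Import all_classical all_reals all_analysis.
From mathcomp Require Import ring lra.
Set Implicit Arguments.
Unset Strict Implicit.
Unset Printing Implicit Defensive.
Import Order.TTheory GRing.Theory Num.Theory.
Import numFieldNormedType.Exports.
Local Open Scope classical_set_scope.
Local Open Scope ring_scope.

(** * Hausdorff dimension *)

Section Hausdorff.
Variable R : realType.
Implicit Types (A B U : set (R * R)) (d : \bar R) (e s t : R).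

Definition has_small_covers s A := forall e, 0 < e ->
  exists U : nat -> set (R * R), [/\ A `<=` \bigcup_n U n,
    forall n, (eucl_diam (U n) <= e%:E)%E &
    (\sum_(0 <= n <oo) diam_pow s (U n) <= e%:E)%E].

(** For [d >= 0] this says that the dimension is at most [d]. Only exponents strictly above [d]
    occur, because the measure at [d] itself may be positive. *)
Definition null_above d A := forall t, (d < t%:E)%E -> has_small_covers t A.

Lemma diam_pow_ge0 s U : (0 <= diam_pow s U)%E.
Proof. by rewrite /diam_pow; case: ifP => // _; exact: poweR_ge0. Qed.

Lemma premeasure_ge0 s e A : (0 <= hausdorff_premeasure s e A)%E.
Proof.
apply: le_ereal_inf_tmp => _ [U _ <-].
by apply: nneseries_ge0 => n *; exact: diam_pow_ge0.
Qed.

Lemma hausdorff_measure_eq0P s A :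
  hausdorff_measure s A = 0%E <-> has_small_covers s A.
Proof.
split=> [m0 e e0|cov].
  have : (hausdorff_premeasure s e A < e%:E)%E.
    rewrite (@le_lt_trans _ _ 0%E) ?lte_fin// -m0.
    by apply: ereal_sup_ubound; exists e.
  move=> /ereal_inf_lt[_ [U [AU dU] <-]] /ltW Ue.
  by exists U.
apply/eqP; rewrite eq_le; apply/andP; split.
  apply: ge_ereal_sup => _ [e e0 <-].
  apply/lee_addgt0Pr => r r0; rewrite add0e.
  have mer : 0 < Num.min e r by rewrite lt_min r0; move: e0 => /= ->.
  have [U [AU dU sU]] := cov _ mer.
  apply: (@le_trans _ _ (Num.min e r)%:E); last by rewrite lee_fin ge_min lexx orbT.
  apply: le_trans sU; apply: ereal_inf_lbound; exists U => //; split=> // n.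
  by rewrite (le_trans (dU n))// lee_fin ge_min lexx.
apply: (le_trans (premeasure_ge0 s 1 A)).
by apply: ereal_sup_ubound; exists 1 => //=.
Qed.

Lemma hausdorff_dim_ge0 A : (0 <= hausdorff_dim A)%E.
Proof. by apply: le_ereal_inf_tmp => _ [s [s0 _] <-]; rewrite lee_fin. Qed.

Lemma eucl_dist_ge0 x y : 0 <= @eucl_dist R x y.
Proof. exact: sqrtr_ge0. Qed.

Lemma eucl_diam_ge0 U : U !=set0 -> (0 <= eucl_diam U)%E.
Proof.
move=> [x Ux]; apply: (@le_trans _ _ (eucl_dist x x)%:E).
  by rewrite lee_fin eucl_dist_ge0.
by apply: ereal_sup_ubound; exists (x, x).
Qed.

Lemma diam_pow_le s t U : 0 <= s -> s < t -> (eucl_diam U <= 1)%E ->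
  (diam_pow t U <= diam_pow s U)%E.
Proof.
move=> s0 st d1; rewrite /diam_pow; case: ifPn => // /set0P/eucl_diam_ge0.
move: d1; case: (eucl_diam U) => [r r1 r0||];
  [|by rewrite leye_eq|by move=> _; rewrite leeNy_eq].
have {}r1 : r <= 1 by rewrite -lee_fin.
have {}r0 : 0 <= r by rewrite -lee_fin.
rewrite /poweR lee_fin.
have [->|rn0] := eqVneq r 0.
  by rewrite powR0 ?gt_eqF ?powR_ge0// (le_lt_trans s0).
by apply: ger_powR; [rewrite lt0r rn0 r0 r1|exact: ltW].
Qed.

Lemma has_small_covers_le s t A : 0 <= s -> s < t ->
  has_small_covers s A -> has_small_covers t A.
Proof.
move=> s0 st cov e e0; have m0 : 0 < Num.min e 1 by rewrite lt_min e0 ltr01.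
have [U [AU dU sU]] := cov _ m0; exists U; split => [//|n|].
  by rewrite (le_trans (dU n))// lee_fin ge_min lexx.
apply: (@le_trans _ _ (Num.min e 1)%:E); last by rewrite lee_fin ge_min lexx.
apply: le_trans sU; apply: lee_nneseries => [n _ _|n _]; first exact: diam_pow_ge0.
apply: diam_pow_le => //; rewrite (le_trans (dU n))// lee_fin ge_min lexx.
by rewrite orbT.
Qed.

Lemma hausdorff_dim_leP d A : (0 <= d)%E ->
  (hausdorff_dim A <= d)%E <-> null_above d A.
Proof.
move=> d0; split=> [Ad t dt|nA].
  have /ereal_inf_lt[_ [s [s0 ms] <-]] := le_lt_trans Ad dt.
  rewrite lte_fin => st; apply: (has_small_covers_le s0 st).
  exact/hausdorff_measure_eq0P.
move: d0 nA; case: d => [r| |] d0 nA; [|by rewrite leey|by []].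
have r0 : 0 <= r by rewrite -lee_fin.
 apply/lee_addgt0Pr => e e0.
apply: ereal_inf_lbound; exists (r + e) => //; split; first by rewrite addr_ge0// ltW.
by apply/hausdorff_measure_eq0P/nA; rewrite lte_fin ltrDl.
Qed.

Lemma null_aboveS d A B : A `<=` B -> null_above d B -> null_above d A.
Proof.
move=> AB nB t dt e e0; have [U [BU ? ?]] := nB t dt e e0.
by exists U; split => //; exact: subset_trans BU.
Qed.

(** On [B] the map [f] has an inverse of Lipschitz constant [l], so covers of [A] pull back to
    covers of [B]. This serves for similarities and for their left inverses alike. *)
Lemma null_above_preimage (f : R * R -> R * R) (l : R) d A B : 0 < l ->
  (forall x y, B x -> B y -> eucl_dist x y <= l * eucl_dist (f x) (f y)) ->
  (0 <= d)%E ->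
  (forall x, B x -> A (f x)) -> null_above d A -> null_above d B.
Proof.
move=> l0 fl d0 BA nA t dt e e0.
have t0 : 0 < t by rewrite -lte_fin (le_lt_trans d0).
have L0 : 0 < Num.max l (l `^ t) by rewrite lt_max l0.
(* Pulling back multiplies diameters by at most [l] and the sum by at most the [t]-th power of [l];
   the maximum absorbs both. *)
pose e' := e / Num.max l (l `^ t).
have e'0 : 0 < e' by rewrite divr_gt0.
have [U [AU dU sU]] := nA t dt e' e'0.
have diamle n : (eucl_diam (B `&` f @^-1` U n) <= l%:E * eucl_diam (U n))%E.
  apply: ge_ereal_sup => _ [[x y] /= [[Bx Ux] [By Uy]] <-].
  apply: (@le_trans _ _ (l * eucl_dist (f x) (f y))%:E); first by rewrite lee_fin fl.
  rewrite EFinM lee_pmul2l ?lte_fin//; apply: ereal_sup_ubound.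
  by exists (f x, f y).
exists (fun n => B `&` f @^-1` U n); split.
- by move=> x Bx; have [n _ ?] := AU _ (BA _ Bx); exists n.
- move=> n; apply: (le_trans (diamle n)).
  apply: (@le_trans _ _ (l%:E * e'%:E)%E); first by rewrite lee_pmul2l ?lte_fin.
  rewrite -EFinM lee_fin /e' mulrCA ger_pMr// ler_pdivrMr// mul1r.
  by rewrite le_max lexx.
- apply: (@le_trans _ _ ((l `^ t)%:E * \sum_(0 <= n <oo) diam_pow t (U n))%E).
    rewrite -nneseriesZl; last by move=> n _; exact: diam_pow_ge0.
    apply: lee_nneseries => [n _ _|n _]; first exact: diam_pow_ge0.
    rewrite /diam_pow; case: ifPn => [_|/set0P ne].
      by rewrite mule_ge0 ?lee_fin ?powR_ge0//; case: ifP => // _; exact: poweR_ge0.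
    have neU : U n !=set0 by case: ne => x [_ ?]; exists (f x).
    case: ifPn => [/eqP U0|_]; first by move: neU; rewrite U0 => -[].
    have := diamle n; have := eucl_diam_ge0 ne; have := eucl_diam_ge0 neU.
    have := dU n.
    case: (eucl_diam (U n)) => [u _ u0|//|//]; rewrite -EFinM.
    case: (eucl_diam (B `&` f @^-1` U n)) => [v v0 vu|//|//].
    have {}u0 : 0 <= u by rewrite -lee_fin.
    have {}v0 : 0 <= v by rewrite -lee_fin.
    have {}vu : v <= l * u by rewrite -lee_fin.
    rewrite /poweR -EFinM lee_fin -powRM ?(ltW l0)//.
    by rewrite ge0_ler_powR ?nnegrE ?(ltW t0)// mulr_ge0// ltW.
  apply: (@le_trans _ _ ((l `^ t)%:E * e'%:E)%E).
    by apply: lee_wpmul2l => //; rewrite lee_fin powR_ge0.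
  rewrite -EFinM lee_fin /e' mulrCA ger_pMr// ler_pdivrMr// mul1r.
  by rewrite le_max lexx orbT.
Qed.

Lemma null_above_bigcup d (F : nat -> set (R * R)) :
  (forall n, null_above d (F n)) -> null_above d (\bigcup_n F n).
Proof.
move=> nF t dt e e0.
have pos n : 0 < e / (2 ^ n.+1)%:R by rewrite divr_gt0// ltr0n expn_gt0.
have /choice[G PG] n := nF n t dt _ (pos n).
have /card_esym/ppcard_eqP[f] := card_nat2.
exists (uncurry G \o f); split.
- move=> x [i _ Fx]; have [cov _ _] := PG i; have [j _ ?] := cov _ Fx.
  by exists (f^-1%FUN (i, j)) => //=; rewrite invK ?inE.
- move=> n /=; case: (f n) => i j /=; have [_ h _] := PG i.
  apply: (le_trans (h j)); rewrite lee_fin ler_pdivrMr ?ltr0n ?expn_gt0//.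
  by rewrite ler_peMr ?(ltW e0)// ler1n expn_gt0.
- rewrite nneseries_esumT; last by move=> n; exact: diam_pow_ge0.
  have := @reindex_esum R _ _ setT setT f (fun ij => diam_pow t (uncurry G ij)).
  rewrite /comp => <-//.
  rewrite (_ : setT = setT `*`` (fun=> setT)); last first.
    by apply/seteqP; split=> -[].
  rewrite (eq_esum (b := fun ij => diam_pow t (G ij.1 ij.2))); last by move=> -[].
  rewrite -(@esum_esum R _ _ setT (fun=> setT)
    (fun i j => diam_pow t (G i j))); last first.
    by move=> i j _ _; exact: diam_pow_ge0.
  apply: (@le_trans _ _ (\sum_(0 <= i <oo) (e / (2 ^ i.+1)%:R)%:E)%E); last first.
    by have := @epsilon_trick0 R e xpredT (ltW e0).
  rewrite nneseries_esumT; last by move=> n; rewrite lee_fin ltW.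
  apply: le_esum => i _; have [_ _ h] := PG i.
  apply: le_trans h; rewrite nneseries_esumT//.
  by move=> n; exact: diam_pow_ge0.
Qed.

Lemma null_above_countable (I : countType) d (F : I -> set (R * R)) :
  (forall i, null_above d (F i)) -> null_above d (\bigcup_i F i).
Proof.
move=> nF.
have n0 : null_above d set0.
  move=> t _ e e0; exists (fun=> set0); split => [? []|n|].
  - by rewrite /eucl_diam set0X image_set0 ereal_sup0 leNye.
  - by rewrite eseries0 ?lee_fin ?ltW// => n _ _; rewrite /diam_pow eqxx.
apply: (@null_aboveS d _ (\bigcup_n (if unpickle n is Some i then F i else set0))).
  by move=> x [i _ Fx]; exists (pickle i) => //; rewrite pickleK.
by apply: null_above_bigcup => n; case: unpickle.
Qed.

Lemma null_aboveU d A B :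
  null_above d A -> null_above d B -> null_above d (A `|` B).
Proof.
move=> nA nB.
apply: (@null_aboveS d _ (\bigcup_b (if b then A else B))).
  by move=> x [Ax|Bx]; [exists true|exists false].
by apply: null_above_countable => -[].
Qed.

Lemma null_above1 d (x : R * R) : (0 <= d)%E -> null_above d [set x].
Proof.
move=> d0 t dt e e0; have t0 : 0 < t by rewrite -lte_fin (le_lt_trans d0).
exists (fun=> [set x]); split.
- by move=> y ->; exists 0%N.
- move=> n; apply: ge_ereal_sup => _ [[a b] [/= -> ->] <-].
  by rewrite /eucl_dist !subrr expr0n/= addr0 sqrtr0 lee_fin ltW.
- rewrite eseries0 ?lee_fin ?ltW// => n _ _; rewrite /diam_pow.
  case: ifPn => // _; rewrite (_ : eucl_diam _ = 0%E).
    by rewrite poweR0r ?gt_eqF.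
  apply/eqP; rewrite eq_le eucl_diam_ge0 ?andbT; last by exists x.
  apply: ge_ereal_sup => _ [[a b] [/= -> ->] <-].
  by rewrite /eucl_dist !subrr expr0n/= addr0 sqrtr0.
Qed.

End Hausdorff.

(** * Topology of the plane *)

(** A nonempty relatively clopen subset of [B] meets [A] by density, hence contains [A]; being
    closed in [B], it is then all of [B]. *)
Lemma connected_between (T : topologicalType) (A B : set T) :
  connected A -> A `<=` B -> B `<=` closure A -> connected B.
Proof.
move=> cA AB Bcl U [x Ux] [C1 oC1 E1] [C2 cC2 E2].
have [Bx C1x] : (B `&` C1) x by rewrite -E1.
have AU : A `&` U = A.
  apply: cA.
  - have [y [Ay C1y]] := Bcl _ Bx _ (open_nbhs_nbhs (conj oC1 C1x)).
    by exists y; split => //; rewrite E1; split => //; exact: AB.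
  - by exists C1 => //; rewrite E1 setIA (setIidl AB).
  - by exists C2 => //; rewrite E2 setIA (setIidl AB).
have AC2 : A `<=` C2 by move=> y; rewrite -{1}AU E2 => -[_ []].
rewrite E2; apply: setIidl => y /Bcl.
by move=> /(closureS AC2); rewrite -(closure_id C2).1.
Qed.

Lemma geometric_lt (R : realType) (r M e : R) : 0 <= r < 1 -> 0 < e ->
  exists n, r ^+ n * M < e.
Proof.
move=> /andP[r0 r1] e0; have : (fun n => r ^+ n * M) @ \oo --> 0 * M.
  by apply: cvgMl; apply: cvg_expr; rewrite ger0_norm.
by rewrite mul0r => /cvgr_lt/(_ _ e0)[n _ h]; exists n; exact: h (leqnn n).
Qed.

Section EuclideanTopology.
Variable R : realType.
Implicit Types x y : R * R.

Lemma ler_eucl_dist1 x y : `|x.1 - y.1| <= eucl_dist x y.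
Proof.
by rewrite -sqrtr_sqr /eucl_dist ler_sqrt ?lerDl ?addr_ge0 ?sqr_ge0.
Qed.

Lemma ler_eucl_dist2 x y : `|x.2 - y.2| <= eucl_dist x y.
Proof.
by rewrite -sqrtr_sqr /eucl_dist ler_sqrt ?lerDr ?addr_ge0 ?sqr_ge0.
Qed.

Lemma eucl_dist_ler x y : eucl_dist x y <= `|x.1 - y.1| + `|x.2 - y.2|.
Proof.
rewrite -[leRHS]ger0_norm ?addr_ge0// -sqrtr_sqr ler_sqrt ?sqr_ge0//.
rewrite [leRHS]sqrrD !real_normK ?num_real// -addrA [_ *+ 2 + _]addrC addrA lerDl.
by rewrite mulrn_wge0 ?mulr_ge0.
Qed.

Lemma eucl_dist_xx x : eucl_dist x x = 0.
Proof. by rewrite /eucl_dist !subrr expr0n/= addr0 sqrtr0. Qed.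

Lemma eucl_dist_eq0 x y : eucl_dist x y <= 0 -> x = y.
Proof.
move=> d0; have := le_trans (ler_eucl_dist1 x y) d0.
have := le_trans (ler_eucl_dist2 x y) d0.
rewrite !normr_le0 !subr_eq0; case: x y {d0} => [a b] [a' b'] /=.
by move=> /eqP -> /eqP ->.
Qed.

Lemma nbhs_euclP x (P : set (R * R)) :
  nbhs x P <-> exists2 e, 0 < e & forall y, eucl_dist x y < e -> P y.
Proof.
split=> [/nbhs_ballP[e /= e0 eP]|[e e0 eP]].
  exists e => // y xy; apply: eP; split; rewrite /ball/=.
    exact: le_lt_trans (ler_eucl_dist1 _ _) xy.
  exact: le_lt_trans (ler_eucl_dist2 _ _) xy.
apply/nbhs_ballP; exists (e / 2) => /=; first by rewrite divr_gt0.
move=> y [xy1 xy2]; apply: eP; apply: (le_lt_trans (eucl_dist_ler _ _)).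
by rewrite [ltRHS]splitr ltrD.
Qed.

Lemma closure_eucl (C : set (R * R)) x :
  (forall e, 0 < e -> exists2 y, C y & eucl_dist x y < e) -> closure C x.
Proof.
move=> h P /nbhs_euclP[e e0 eP]; have [y Cy xy] := h e e0.
by exists y; split => //; exact: eP.
Qed.

Lemma compact_eucl_bounded (K : set (R * R)) : compact K ->
  exists2 M, 0 < M & forall x y, K x -> K y -> eucl_dist x y <= M.
Proof.
move=> /compact_bounded[M [_ Mb]].
have bd z : K z -> `|z| <= `|M| + 1.
  by apply: (Mb (`|M| + 1)); rewrite (le_lt_trans (ler_norm _))// ltrDl.
exists ((`|M| + 1) *+ 4); first by rewrite mulrn_wgt0 // ltr_wpDl.
move=> x y /bd + /bd; rewrite !prod_normE/= !ge_max.
move=> /andP[x1 x2] /andP[y1 y2]; apply: (le_trans (eucl_dist_ler _ _)).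
have := ler_normB x.1 y.1; have := ler_normB x.2 y.2; lra.
Qed.

End EuclideanTopology.

(** * Star-shaped iterated function systems *)

(* The index [None] stands for the central map [S0]. *)
Section StarSystem.
Variable R : realType.
Let I := option 'I_3.
Variables (K : set (R * R)) (f : I -> R * R -> R * R) (rho : I -> R) (r : R).
Variables (A c : 'I_3 -> R * R) (O : R * R).
Hypotheses (cK : compact K) (KE : K = \bigcup_i (f i @` K)).
Hypotheses (rho0 : forall i, 0 < rho i) (rho_r : forall i, rho i <= r) (r1 : r < 1).
Hypothesis fE : forall i x y, eucl_dist (f i x) (f i y) = rho i * eucl_dist x y.
Hypotheses (fO : f None O = O) (KO : K O) (KA : forall a, K (A a)).
Hypothesis fA : forall a, f (Some a) (A a) = A a.
Hypothesis fB : forall a, f None (A a) = f (Some a) (c a).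
Hypothesis Kc : forall a, (f (Some (a + 1)) @` K) (c a).
Hypothesis meet0 : forall a y z, K y -> K z ->
  f None y = f (Some a) z -> f None y = f None (A a).
Hypothesis disj : forall a b y z, K y -> K z ->
  f (Some a) y = f (Some b) z -> a = b.
Implicit Types (i j : I) (a b : 'I_3) (x y z : R * R) (C D : set (R * R)) (w : seq I).

(** * Cells and the retractions onto them *)

Lemma fK i z : K z -> K (f i z).
Proof. by move=> Kz; rewrite KE; exists i => //; exists z. Qed.

Lemma K_split x : K x -> exists i, exists2 z, K z & x = f i z.
Proof. by rewrite {1}KE => -[i _ [z Kz <-]]; exists i, z. Qed.

Lemma f_inj i : injective (f i).
Proof.
move=> x y xy; apply: eucl_dist_eq0; rewrite -(ler_pM2l (rho0 i)) -fE xy.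
by rewrite eucl_dist_xx mulr0.
Qed.

Lemma f_cont i : continuous (f i).
Proof.
move=> x P /nbhs_euclP[e e0 eP]; apply/nbhs_euclP; exists (e / rho i).
  by rewrite divr_gt0.
by move=> y xy; apply: eP; rewrite fE mulrC -ltr_pdivlMr.
Qed.

Lemma closed_fK i : closed (f i @` K).
Proof.
apply: compact_closed; first exact: norm_hausdorff.
by apply: continuous_compact => //; apply: continuous_subspaceT; exact: f_cont.
Qed.

Lemma Kc' a : K (c a).
Proof. by case: (Kc a) => z Kz <-; exact: fK. Qed.

(* The point of [K] that [phi i] takes on [f j @` K] when [j <> i]; the value at
   [None], [None] is never used. *)
Definition port i j : R * R :=
  match i, j with
  | Some a, _ => c a
  | None, Some b => A b
  | None, None => O
  end.

Lemma K_port i j : K (port i j).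
Proof. by case: i j => [a|] [b|] //=; exact: Kc'. Qed.

(* [phi i] is [f i]^-1 after the retraction of [K] onto [f i @` K]. *)
Definition phi i x : R * R :=
  xget (port i (xget None [set j | (f j @` K) x])) [set z | K z /\ f i z = x].

Lemma phi_f i z : K z -> phi i (f i z) = z.
Proof.
move=> Kz; rewrite /phi; apply: xget_unique => // y [Ky]; exact: f_inj.
Qed.

(** Corner cells are disjoint, and the central cell meets the corner cell [a] only in the junction
    point [f None (A a) = f (Some a) (c a)]; the port is the preimage of that point. *)
Lemma f_port i j y z : i <> j -> K y -> K z -> f i y = f j z -> y = port i j.
Proof.
case: i j => [a|] [b|] //= ij Ky Kz yz.
- by case: ij; rewrite (disj Ky Kz yz).
- by apply: (@f_inj (Some a)); rewrite -fB yz; apply: meet0 (esym yz).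
- by apply: (@f_inj None); exact: meet0 yz.
Qed.

Lemma phi_port i j z : i <> j -> K z -> phi i (f j z) = port i j.
Proof.
move=> ij Kz; rewrite /phi; case: xgetP => [y _ [Ky]|noy]; first exact: f_port.
case: xgetP => [k _ [y Ky yz]|noj]; last by case: (noj j); exists z.
(* For [i = Some a] the port does not depend on the cell. For [i = None] the cell picked by [xget]
   must be that of [j]: corner cells are disjoint, and the central cell would give a preimage. *)
case: i ij noy => [//|] ij noy; case: j ij yz noy => [b _|//] yz noy.
case: k yz => [a yz|yz] /=; first by rewrite (disj Ky Kz yz).
by case: (noy y); split.
Qed.

Lemma K_phi i x : K x -> K (phi i x).
Proof.
move=> /K_split[j [z Kz ->]]; have [->|/eqP ij] := eqVneq i j; first by rewrite phi_f.
by rewrite phi_port//; exact: K_port.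
Qed.

Lemma f_phi i x : K x -> f i (phi i x) = x \/ exists a, f i (phi i x) = f None (A a).
Proof.
move=> /K_split[j [z Kz ->]]; have [->|/eqP ij] := eqVneq i j.
  by left; rewrite phi_f.
right; rewrite phi_port//; case: i j ij => [a|] [b|] //= _.
- by exists a; rewrite fB.
- by exists a; rewrite fB.
- by exists b.
Qed.

(** The cells are finitely many closed sets, so some neighbourhood of [x] avoids all those that do
    not contain [x]. *)
Lemma near_cells x : \forall y \near x, forall j, (f j @` K) y -> (f j @` K) x.
Proof.
suff near_cell j : \forall y \near x, (f j @` K) y -> (f j @` K) x.
  exact: filter_forall near_cell.
have [fx|nfx] := pselect ((f j @` K) x); first by near=> y.
have : nbhs x (~` (f j @` K)).
  by apply: open_nbhs_nbhs; split => //; apply: closed_openC; exact: closed_fK.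
by apply: filterS => y /= + /[dup].
Unshelve. all: by end_near. Qed.

Lemma phi_locally_constant i x : K x -> ~ (f i @` K) x ->
  \forall y \near x, K y -> phi i y = phi i x.
Proof.
move=> Kx nx; near=> y => /K_split[j [z Kz yE]].
have cell : forall j, (f j @` K) y -> (f j @` K) x.
  by near: y; exact: near_cells.
have [z' Kz' xE] : (f j @` K) x by apply: cell; exists z.
have ij : i <> j by move=> ij; apply: nx; rewrite ij; exists z'.
by rewrite yE -xE !phi_port.
Unshelve. all: by end_near. Qed.

Lemma phi_lip i j x y : (f j @` K) x -> (f j @` K) y ->
  rho i * eucl_dist (phi i x) (phi i y) <= eucl_dist x y.
Proof.
move=> [x' Kx' <-] [y' Ky' <-]; have [->|/eqP ij] := eqVneq i j.
  by rewrite !phi_f// fE.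
by rewrite !phi_port// eucl_dist_xx mulr0 eucl_dist_ge0.
Qed.

Lemma phi_cvg i x (P : set (R * R)) : K x -> nbhs (phi i x) P ->
  \forall y \near x, K y -> P (phi i y).
Proof.
move=> Kx /nbhs_euclP[e e0 eP]; near=> y => Ky; apply: eP.
rewrite -(ltr_pM2l (rho0 i)).
have cell : forall j, (f j @` K) y -> (f j @` K) x.
  by near: y; exact: near_cells.
have [j [z Kz yE]] := K_split Ky.
have yj : (f j @` K) y by exists z.
apply: (le_lt_trans (phi_lip i (cell _ yj) yj)).
near: y; apply/nbhs_euclP; exists (rho i * e) => //; exact: mulr_gt0.
Unshelve. all: by end_near. Qed.

Lemma phi_connected i C : C `<=` K -> connected C -> connected (phi i @` C).
Proof.
move=> CK cC; apply: connected_continuous_connected => //.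
apply: (continuous_subspaceW CK); apply/subspace_continuousP => x Kx P /=.
by move=> /(phi_cvg Kx).
Qed.

(** Other cells meet the corner cell [a] only in its junction point. If [C] avoided that point, its
    trace on the cell would be clopen in [C], and [C] could not leave the cell. *)
Lemma touch C a x y j : C `<=` K -> connected C -> C x -> C y ->
  (f (Some a) @` K) x -> (f j @` K) y -> j <> Some a -> C (f None (A a)).
Proof.
move=> CK cC Cx Cy ax jy ja; apply: contrapT => nB.
have B_only z i : C z -> (f (Some a) @` K) z -> (f i @` K) z -> i = Some a.
  move=> Cz [u Ku uz] [v Kv vz]; apply: contrapT => ia; apply: nB.
  have Ka : Some a <> i by move=> ai; apply: ia.
  have uv : f (Some a) u = f i v by rewrite uz vz.
  by rewrite fB -[c a]/(port (Some a) i) -(f_port Ka Ku Kv uv) uz.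
have E : C `&` (f (Some a) @` K) = C.
  apply: cC.
  - by exists x.
  - exists (~` \bigcup_(i in [set i | i <> Some a]) (f i @` K)).
      apply: closed_openC; apply: closed_bigcup => [|i _]; last exact: closed_fK.
      exact: finite_finset.
    apply/seteqP; split=> z [Cz].
      move=> az; split => // -[i ia iz].
      by apply: ia; exact: B_only Cz az iz.
    move=> nz; split => //; have [i [u Ku zu]] := K_split (CK _ Cz).
    have [ia|ia] := pselect (i = Some a); first by exists u => //; rewrite -ia.
    by case: nz; exists i => //; exists u.
  - by exists (f (Some a) @` K) => //; exact: closed_fK.
by apply: ja; apply: (B_only y) => //; move: Cy; rewrite -{1}E => -[].
Qed.

(** A point of [C] in another cell is retracted to a junction point; [C] also meets the cell [i], so
    by [touch] it passes through that point. *)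
Lemma f_phi_sub C i x : C `<=` K -> connected C -> C x -> (f i @` K) x ->
  forall y, C y -> C (f i (phi i y)).
Proof.
move=> CK cC Cx ix y Cy; have [j [z Kz yE]] := K_split (CK _ Cy).
have jy : (f j @` K) y by exists z.
have [ij|/eqP ij] := eqVneq i j; first by rewrite yE ij phi_f// -yE.
rewrite {1}yE phi_port//; case: i j ij ix jy {yE} => [a|] [b|] //= ij ix jy.
- rewrite -fB; apply: (touch CK cC Cx Cy ix jy); exact/nesym.
- by rewrite -fB; apply: (touch CK cC Cx Cy ix jy).
- by apply: (touch CK cC Cy Cx jy ix).
Qed.

Lemma eucl_dist_foldr w x y :
  eucl_dist (foldr f x w) (foldr f y w) <= r ^+ size w * eucl_dist x y.
Proof.
elim: w => [|i w IH] /=; first by rewrite expr0 mul1r.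
rewrite fE exprS -mulrA; apply: ler_pM => //; first exact/ltW.
exact: eucl_dist_ge0.
Qed.

Lemma foldr_cell x n : K x -> exists w, exists2 z, size w = n & K z /\ x = foldr f z w.
Proof.
elim: n x => [|n IH] x Kx; first by exists [::], x.
have [i [y Ky ->]] := K_split Kx; have [w [z sw [Kz ->]]] := IH y Ky.
by exists (i :: w), z => //=; rewrite sw.
Qed.

Lemma small_cells e : 0 < e -> exists n, forall w x y, size w = n -> K x -> K y ->
  eucl_dist (foldr f x w) (foldr f y w) < e.
Proof.
move=> e0; have [M M0 KM] := compact_eucl_bounded cK.
have r0 : 0 <= r by exact: le_trans (ltW (rho0 None)) (rho_r _).
have [|n h] := @geometric_lt _ r M e _ e0; first by rewrite r0.
exists n => w x y sw Kx Ky; apply: (le_lt_trans (eucl_dist_foldr _ _ _)).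
apply: le_lt_trans h; rewrite sw ler_wpM2l ?exprn_ge0//.
exact: KM.
Qed.

(** * Connected sets of controlled dimension *)

Lemma null_above_fV d i C D : (0 <= d)%E -> C `<=` K -> (forall x, D x -> C (f i x)) ->
  null_above d C -> null_above d D.
Proof.
move=> d0 CK DC; apply: (@null_above_preimage _ (f i) (rho i)^-1) => //.
  by rewrite invr_gt0.
by move=> x y _ _; rewrite fE mulKf ?gt_eqF.
Qed.

Lemma null_above_f d i C : (0 <= d)%E -> C `<=` K ->
  null_above d C -> null_above d (f i @` C).
Proof.
move=> d0 CK; apply: (@null_above_preimage _ (phi i) (rho i)) => //.
- move=> _ _ [x Cx <-] [y Cy <-].
  by rewrite fE !phi_f//; exact: CK.
- by move=> _ [x Cx <-]; rewrite phi_f//; exact: CK.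
Qed.

Definition thin_connected d C := [/\ C `<=` K, connected C & null_above d C].

(** By [f_phi_sub] the image of [C] under [phi i] is a rescaled copy of a subset of [C], so the
    dimension bound survives. *)
Lemma thin_phi d i C x : (0 <= d)%E -> thin_connected d C -> C x -> (f i @` K) x ->
  thin_connected d (phi i @` C).
Proof.
move=> d0 [CK cC nC] Cx ix; split.
- by move=> _ [y Cy <-]; apply: K_phi; exact: CK.
- exact: phi_connected.
- apply: (@null_above_fV d i C) => // _ [y Cy <-]; exact: (f_phi_sub CK cC Cx ix).
Qed.

Lemma thin_f d i C : (0 <= d)%E -> thin_connected d C -> thin_connected d (f i @` C).
Proof.
move=> d0 [CK cC nC]; split.
- by move=> _ [x Cx <-]; apply: fK; exact: CK.
- apply: connected_continuous_connected => //.
  by apply: continuous_subspaceT; exact: f_cont.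
- exact: null_above_f.
Qed.

Lemma core_cell a : (f (Some a) @` K) (A a).
Proof. by exists (A a). Qed.

Lemma phiA a : phi None (A a) = A a.
Proof. by rewrite -{1}fA phi_port. Qed.

Lemma foldr_fixed n : foldr f O (nseq n None) = O.
Proof. by elim: n => //= n ->. Qed.

(** Induction on the depth: [phi None] fixes every [A a], so the image of [C] satisfies the same
    hypotheses. As [C] contains [f None (A a)], [f_phi_sub] brings the point found there back into
    [C]. *)
Lemma meets_core n a b C : a != b -> C `<=` K -> connected C -> C (A a) -> C (A b) ->
  exists2 z, K z & C (foldr f z (nseq n None)).
Proof.
move=> ab; elim: n C => [|n IH] C CK cC Ca Cb; first by exists (A a).
have [||||z Kz [y Cy yE]] := IH (phi None @` C).
- by move=> _ [y Cy <-]; apply: K_phi; exact: CK.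
- exact: phi_connected.
- by exists (A a); rewrite ?phiA.
- by exists (A b); rewrite ?phiA.
exists z => //=; rewrite -yE; apply: (@f_phi_sub C None (f None (A a))) => //.
- apply: (touch CK cC Ca Cb (core_cell a) (core_cell b)).
  by move=> [/esym/eqP]; exact/negP.
- by exists (A a).
Qed.

Lemma O_in_closure C a b : a != b -> C `<=` K -> connected C -> C (A a) -> C (A b) ->
  closure C O.
Proof.
move=> ab CK cC Ca Cb; apply: closure_eucl => e /small_cells[n small].
have [z Kz Cz] := meets_core n ab CK cC Ca Cb.
exists (foldr f z (nseq n None)) => //.
by rewrite -{1}(foldr_fixed n); apply: small => //; exact: size_nseq.
Qed.

Lemma thin_addO d C : (0 <= d)%E -> thin_connected d C -> closure C O ->
  thin_connected d (C `|` [set O]).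
Proof.
move=> d0 [CK cC nC] clO; split.
- by move=> x [/CK|->].
- apply: (connected_between cC) => x; first by left.
  by case=> [Cx|->//]; exact: subset_closure.
- by apply: null_aboveU => //; exact: null_above1.
Qed.

Lemma thin_next d a C : (0 <= d)%E -> thin_connected d C -> C O -> C (A a) ->
  (exists E, [/\ thin_connected d E, E O & E (A (a + 1))]) /\
  (exists E, [/\ thin_connected d E, E O & E (c a)]).
Proof.
move=> d0 tC CO Ca; have a1 : a != a + 1 by case: a {tC CO Ca} => -[|[|[|]]].
have tD := thin_phi d0 tC Ca (core_cell a).
set D := phi (Some a) @` C in tD.
(* [O] lies in the central cell, which [phi (Some a)] collapses to [c a]. *)
have Dc : D (c a) by exists O => //; rewrite -{1}fO phi_port.
have Da : D (A a) by exists (A a) => //; rewrite -{1}fA phi_f.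
have DB : D (f None (A a)).
  case: tD => DK cD _; apply: (touch DK cD Da Dc (core_cell a) (Kc a)).
  by move=> [/esym/eqP]; exact/negP.
have B0 : (f None @` K) (f None (A a)) by exists (A a).
have tE := thin_phi d0 tD DB B0.
have DE : f None @` (phi None @` D) `<=` D.
  move=> _ [_ [y Dy <-] <-].
  by case: (tD) => DK cD _; exact: f_phi_sub DK cD DB B0 _ Dy.
set E := phi None @` D in tE DE.
have Ea : E (A a) by exists (A a) => //; exact: phiA.
(* [c a] lies in the corner cell [a + 1], which [phi None] collapses to [A (a + 1)]. *)
have Ea1 : E (A (a + 1)).
  by exists (c a) => //; case: (Kc a) => z Kz <-; rewrite phi_port.
have clE : closure E O by case: tE => EK cE _; exact: O_in_closure a1 EK cE Ea Ea1.
(* [D] contains the image of [E] under [f None], which is continuous and fixes [O]. *)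
have clD : closure D O.
  apply: (closureS DE); rewrite -fO => P /(@f_cont None O)/clE[y [Ey Py]].
  by exists (f None y); split => //; exists y.
split.
- by exists (E `|` [set O]); split; [exact: thin_addO|right|left].
- by exists (D `|` [set O]); split; [exact: thin_addO|right|left].
Qed.

Lemma thin_arms d C : (0 <= d)%E -> thin_connected d C -> C O -> C (A 0) ->
  forall a, exists E, [/\ thin_connected d E, E O & E (A a)].
Proof.
move=> d0 tC CO C0 a.
have [[E1 [tE1 E1O E1A]] _] := thin_next d0 tC CO C0.
have [[E2 [tE2 E2O E2A]] _] := thin_next d0 tE1 E1O E1A.
case: a => -[|[|[|//]]] a3; [exists C|exists E1|exists E2]; split => //.
- by rewrite (_ : Ordinal a3 = 0)//; exact/val_inj.
- by rewrite (_ : Ordinal a3 = 0 + 1)//; exact/val_inj.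
- by rewrite (_ : Ordinal a3 = 0 + 1 + 1)//; exact/val_inj.
Qed.

Lemma thin_U d C D x : thin_connected d C -> thin_connected d D -> C x -> D x ->
  thin_connected d (C `|` D).
Proof.
move=> [CK cC nC] [DK cD nD] Cx Dx; split.
- by move=> y [/CK|/DK].
- by apply: connectedU => //; exists x.
- exact: null_aboveU.
Qed.

Lemma thin_bigcup d (J : countType) (F : J -> set (R * R)) x :
  (forall k, thin_connected d (F k)) -> (forall k, F k x) ->
  thin_connected d (\bigcup_k F k).
Proof.
move=> tF Fx; split.
- by move=> y [k _ Fy]; case: (tF k) => + _ _; exact.
- by apply: bigcup_connected => [|k _]; [exists x => k _|case: (tF k)].
- by apply: null_above_countable => k; case: (tF k).
Qed.

Lemma thin_hub d C : (0 <= d)%E -> thin_connected d C -> C O -> C (A 0) ->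
  exists G, [/\ thin_connected d G, G O & forall i, G (f i O)].
Proof.
move=> d0 tC CO C0; have arms := thin_arms d0 tC CO C0.
have ex_arm a : exists G, [/\ thin_connected d G, G O & G (f (Some a) O)].
  have [E [tE EO Ea]] := arms a.
  have [_ [D [tD DO Dc]]] := thin_next d0 tE EO Ea.
  (* The first piece joins [O] to the junction point of the corner cell [a]; the second continues
     from there to [f (Some a) O]. *)
  exists (f None @` E `|` f (Some a) @` D); split.
  - apply: (@thin_U d _ _ (f None (A a))); [exact: thin_f|exact: thin_f|by exists (A a)|].
    by rewrite fB; exists (c a).
  - by left; exists O.
  - by right; exists O.
have [G tG] := choice ex_arm.
exists (\bigcup_a G a); split.
- by apply: (@thin_bigcup d _ G O) => a; case: (tG a).
- by exists 0 => //; case: (tG 0).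
- move=> [a|]; first by exists a => //; case: (tG a).
  by rewrite fO; exists 0 => //; case: (tG 0).
Qed.

(** Images of the hub under all prefixes of [w]: a chain of hubs from [O] to [foldr f O w]. All
    chains share [O], which makes their union over all words connected. *)
Fixpoint prefix_hubs (G : set (R * R)) w : set (R * R) :=
  if w is i :: w' then G `|` f i @` prefix_hubs G w' else G.

Lemma null_above_cut_points d C : (0 <= d)%E -> thin_connected d C -> C O -> C (A 0) ->
  null_above d (cut_points K).
Proof.
move=> d0 tC CO C0; have [G [tG GO Gf]] := thin_hub d0 tC CO C0.
have PO w : prefix_hubs G w O by case: w => //= i w; left.
have PwO w : prefix_hubs G w (foldr f O w).
  by elim: w => //= i w IH; right; exists (foldr f O w).
have tT : thin_connected d (\bigcup_w prefix_hubs G w).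
  apply: (@thin_bigcup d _ (prefix_hubs G) O) => //.
  elim=> [|i w IH] //=; apply: (@thin_U d _ _ (f i O)) => //; first exact: thin_f.
  by exists O.
(* Without [x], [K] still lies between the union of the chains and its closure: that union contains
   all points [foldr f O w], which are dense in [K]. *)
case: tT => TK cT; apply: null_aboveS => x [Kx ncut]; apply: contrapT => nTx.
apply: ncut; apply: (connected_between cT).
- by move=> y Ty; split; [exact: TK|move=> yx; apply: nTx; rewrite -yx].
- move=> y [Ky _]; apply: closure_eucl => e /small_cells[n small].
  have [w [z sw [Kz ->]]] := foldr_cell n Ky.
  by exists (foldr f O w); [exists w|exact: small].
Qed.

(* [Phi n] forgets everything outside the [n]-th cell of the itinerary [s] and
   rescales that cell to [K]. *)
Section Itinerary.
Variables (s : nat -> I).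

Fixpoint Phi n x : R * R := if n is n'.+1 then phi (s n') (Phi n' x) else x.

Lemma K_Phi n x : K x -> K (Phi n x).
Proof. by move=> Kx; elim: n => //= n; exact: K_phi. Qed.

Lemma Phi_foldr n z : K z -> Phi n (foldr f z (mkseq s n)) = z.
Proof.
elim: n z => // n IH z Kz; rewrite mkseqS foldr_rcons /= IH ?phi_f//; exact: fK.
Qed.

Lemma Phi_cvg n x (P : set (R * R)) : K x -> nbhs (Phi n x) P ->
  \forall y \near x, K y -> P (Phi n y).
Proof.
elim: n P => /= [|n IH] P Kx; first by apply: filterS => y Py _.
move=> /(phi_cvg (K_Phi n Kx))/(IH _ Kx); apply: filterS => y h Ky.
by apply: h => //; exact: K_Phi.
Qed.

(** At the depth where [x] leaves the nested cells of [s], the next [phi] is locally constant near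
    the image of [x] and the earlier ones are continuous; all later maps preserve local
    constancy. *)
Lemma Phi_locally_constant n x : K x ->
  ~ ((fun z => foldr f z (mkseq s n)) @` K) x ->
  \forall y \near x, K y -> Phi n y = Phi n x.
Proof.
move=> Kx; elim: n => [|n IH] nx; first by case: nx; exists x.
have [[z Kz zx]|/IH] := pselect (((fun z => foldr f z (mkseq s n)) @` K) x); last first.
  by apply: filterS => y h Ky /=; rewrite h.
have PhiE : Phi n x = z by rewrite -zx Phi_foldr.
have nz : ~ (f (s n) @` K) (Phi n x).
  rewrite PhiE => -[u Ku uz]; apply: nx; exists u => //.
  by rewrite mkseqS foldr_rcons uz.
have := Phi_cvg Kx (phi_locally_constant (K_Phi n Kx) nz).
by apply: filterS => y h Ky /=; apply: h => //; exact: K_Phi.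
Qed.

Lemma Phi_stable n m x y : (n <= m)%N -> Phi n x = Phi n y -> Phi m x = Phi m y.
Proof.
move=> nm xy; rewrite -(subnK nm); elim: (m - n)%N => //= k ->.
by [].
Qed.

(** Iterates [f_phi_sub]; connectedness of the image is carried along because the next iteration
    needs it. *)
Lemma foldr_Phi_sub n C z : C `<=` K -> connected C -> K z ->
  C (foldr f z (mkseq s n)) ->
  [/\ connected (Phi n @` C) & forall y, C y -> C (foldr f (Phi n y) (mkseq s n))].
Proof.
move=> CK cC; elim: n z => [|n IH] z Kz Cz.
  by split => [|y Cy] //=; rewrite image_id.
have Kfz : K (f (s n) z) by exact: fK.
rewrite mkseqS foldr_rcons in Cz; have [cP PC] := IH _ Kfz Cz.
have PK : Phi n @` C `<=` K by move=> _ [y Cy <-]; apply: K_Phi; exact: CK.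
split.
  rewrite (_ : Phi n.+1 @` C = phi (s n) @` (Phi n @` C)); first exact: phi_connected.
  by rewrite -image_comp.
move=> y Cy; rewrite mkseqS foldr_rcons /=.
have Pz : (Phi n @` C) (f (s n) z).
  by exists (foldr f (f (s n) z) (mkseq s n)) => //; rewrite Phi_foldr.
have sz : (f (s n) @` K) (f (s n) z) by exists z.
have Py : (Phi n @` C) (Phi n y) by exists y.
have [y' Cy' <-] := f_phi_sub PK cP Pz sz Py.
exact: PC.
Qed.

End Itinerary.

(** * Cutting [K] at points of the arc *)

Lemma itinerary x : K x -> exists s : nat -> I,
  forall n, exists2 z, K z & x = foldr f z (mkseq s n).
Proof.
move=> Kx.
(* [g] picks a cell and a preimage for each point of [K], and iterating it gives one address among
   possibly several. The pair [(None, O)] is a default outside [K]. *)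
have /choice[g gP] y : exists p : I * (R * R), K y -> K p.2 /\ y = f p.1 p.2.
  have [Ky|nKy] := pselect (K y); last by exists (None, O).
  by have [i [z Kz ->]] := K_split Ky; exists (i, z).
pose xs := fix xs n := if n is n'.+1 then (g (xs n')).2 else x.
exists (fun n => (g (xs n)).1) => n; exists (xs n).
  by elim: n => //= n /gP[].
elim: n => // n IH; rewrite mkseqS foldr_rcons {1}IH /=.
have Kn : K (xs n) by elim: n {IH} => //= n /gP[].
by rewrite -(gP _ Kn).2.
Qed.

Lemma arc_point_cut a (g : R -> R * R) (t : R) :
  {within `[0, 1], continuous g} -> set_inj `[0, 1] g ->
  g 0 = O -> g 1 = A a -> g @` `[0, 1] `<=` K -> 0 < t < 1 ->
  (forall w b, g t <> foldr f (f None (A b)) w) ->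
  cut_points K (g t).
Proof.
move=> cg ig g0 g1 gK /andP[t0 t1] notB.
have Kx : K (g t) by apply: gK; exists t => //=; rewrite in_itv/= !ltW.
split => // cKx; set x := g t in Kx cKx notB.
have arcP u v : 0 <= u -> v <= 1 -> connected (g @` `[u, v]) /\ g @` `[u, v] `<=` K.
  move=> u0 v1.
  have sub : `[u, v]%classic `<=` `[0, 1]%classic by apply: subset_itv; rewrite bnd_simp.
  split; last by move=> _ [q /sub qI <-]; apply: gK; exists q.
  apply: connected_continuous_connected; first exact: segment_connected.
  exact: continuous_subspaceW cg.
have I0 : `[0, 1]%classic (0 : R) by rewrite /= in_itv/= lexx ler01.
have I1 : `[0, 1]%classic (1 : R) by rewrite /= in_itv/= lexx ler01.
have It : `[0, 1]%classic t by rewrite /= in_itv/= !ltW.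
have xO : O <> x.
  by rewrite -g0 => /ig; rewrite !inE => /(_ I0 It) t00; rewrite t00 ltxx in t0.
have xA : A a <> x.
  by rewrite -g1 => /ig; rewrite !inE => /(_ I1 It) t11; rewrite t11 ltxx in t1.
have [s sP] := itinerary Kx.
(* A small enough cell around [x] does not contain [y], so the corresponding [Phi s n] is constant
   on [K] near [y]. *)
have loc y : K y -> y <> x ->
    exists n, \forall y' \near y, K y' -> Phi s n y' = Phi s n y.
  move=> Ky yx; have d0 : 0 < eucl_dist y x.
    by rewrite ltNge; apply/negP => /eucl_dist_eq0.
  have [n small] := small_cells d0; exists n; apply: Phi_locally_constant => //.
  move=> [z Kz zy]; have [z' Kz' xz'] := sP n.
  have := small (mkseq s n) z z' (size_mkseq _ _) Kz Kz'.
  by rewrite zy -xz' ltxx.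
pose U := [set y | [/\ K y, y <> x & exists n, Phi s n y = Phi s n O]].
(* Agreement at one depth persists at all larger ones, so [n] can be raised to a depth of local
   constancy. Thus [U] is open and closed in [K] minus [x], hence all of it. *)
have UE : U = K `\ x.
  apply: cKx.
  - by exists O; split => //; exists 0%N.
  - exists ([set y | K y -> y <> x -> U y]°); first exact: open_interior.
    apply/seteqP; split => [y [Ky yx [n yO]]|y [[Ky yx] /interior_subset Uy]].
      split => //; have [m my] := loc _ Ky yx.
      apply: filterS my => y' h Ky' y'x; split => //; exists (maxn n m).
      rewrite -(Phi_stable (leq_maxl n m) yO).
      by apply: (Phi_stable (leq_maxr n m)); exact: h.
    exact: Uy.
  - exists (closure U); first exact: closed_closure.
    apply/seteqP; split => [y Uy|y [[Ky yx] clU]].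
      by split; [case: Uy|exact: subset_closure].
    split => //; have [m my] := loc _ Ky yx.
    have [y' [[Ky' _ [n y'O]] h]] := clU _ my.
    exists (maxn n m); rewrite -(Phi_stable (leq_maxl n m) y'O).
    by apply/esym/(Phi_stable (leq_maxr n m)); exact: h.
have [_ _ [n AO]] : U (A a) by rewrite UE; split.
have [z Kz xz] := sP n.
have [cL LK] := arcP 0 t (lexx _) (ltW t1).
have [cR RK] := arcP t 1 (ltW t0) (lexx _).
have Lx : (g @` `[0, t]) (foldr f z (mkseq s n)).
  by rewrite -xz; exists t => //=; rewrite in_itv/= lexx ltW.
have Rx : (g @` `[t, 1]) (foldr f z (mkseq s n)).
  by rewrite -xz; exists t => //=; rewrite in_itv/= lexx ltW.
(* [O] and [A a] lie on different halves of the arc and are retracted to the same point of the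
   [n]-th cell. That point lies on both halves, so it is [x] by injectivity. *)
have [u /= uI uE] : (g @` `[0, t]) (foldr f (Phi s n O) (mkseq s n)).
  apply: (foldr_Phi_sub LK cL Kz Lx).2.
  by exists 0 => //=; rewrite in_itv/= lexx ltW.
have [v /= vI vE] : (g @` `[t, 1]) (foldr f (Phi s n O) (mkseq s n)).
  rewrite -AO; apply: (foldr_Phi_sub RK cR Kz Rx).2.
  by exists 1 => //=; rewrite in_itv/= lexx ltW.
move: uI vI; rewrite !in_itv/= => /andP[u0 ut] /andP[tv v1].
have uv : u = v.
  have u1 := le_trans ut (ltW t1); have v0 := le_trans (ltW t0) tv.
  by apply: ig; rewrite ?inE/= ?in_itv/= ?u0 ?v1 ?u1 ?v0// uE.
have ut' : u = t by apply/eqP; rewrite eq_le ut uv.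
have xn : Phi s n O = Phi s n x.
  by rewrite /x -ut' uE Phi_foldr//; exact: K_Phi.
(* If equality first appeared at depth [m.+1], the cell [s m] would retract [Phi s m O] to the
   different point [Phi s m x]. The latter would be a junction point, and [x] one of the points
   excluded by [notB]. *)
suff noteq m : Phi s m O <> Phi s m x by exact: (noteq n).
elim: m => [//|m IH] /= eqm.
have [z' Kz' xz'] := sP m.+1.
have PxE : Phi s m x = f (s m) z'.
  by rewrite {1}xz' mkseqS foldr_rcons Phi_foldr//; exact: fK.
have PxE' : f (s m) (phi (s m) (Phi s m x)) = Phi s m x by rewrite PxE phi_f.
have [] := f_phi (s m) (K_Phi s m KO); rewrite eqm PxE'; first by move/esym.
move=> [b bE]; apply: (notB (mkseq s m) b).
by rewrite -bE PxE -foldr_rcons -mkseqS.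
Qed.

(** Up to the two ends and the countably many images of junction points, the arc consists of cut
    points. *)
Lemma null_above_arc d a (gamma : set (R * R)) : (0 <= d)%E ->
  is_arc gamma O (A a) -> gamma `<=` K ->
  null_above d (cut_points K) -> null_above d gamma.
Proof.
move=> d0 [g [cg ig g0 g1 ->]] gK nCP.
pose B := \bigcup_(wb : seq I * 'I_3) [set foldr f (f None (A wb.2)) wb.1].
have nB : null_above d B by apply: null_above_countable => wb; exact: null_above1.
have nall := null_aboveU (null_aboveU (null_above1 O d0) (null_above1 (A a) d0))
  (null_aboveU nCP nB).
apply: null_aboveS nall => _ [t /= tI <-].
have [->|tn0] := eqVneq t 0; first by left; left.
have [->|tn1] := eqVneq t 1; first by left; right.
right; have [Bt|nBt] := pselect (B (g t)); first by right.
left; apply: (arc_point_cut cg ig g0 g1 gK).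
  by move: tI; rewrite in_itv/= !lt_neqAle eq_sym tn0 tn1.
by move=> w b gt; apply: nBt; exists (w, b).
Qed.

Lemma star_cut_points_dim (gamma : set (R * R)) :
  is_arc gamma O (A 0) -> gamma `<=` K ->
  hausdorff_dim (cut_points K) = hausdorff_dim gamma.
Proof.
move=> arc gK; apply/eqP; rewrite eq_le; apply/andP; split; last first.
  apply/(hausdorff_dim_leP _ (hausdorff_dim_ge0 _)).
  apply: (null_above_arc _ arc gK); first exact: hausdorff_dim_ge0.
  by apply/(hausdorff_dim_leP _ (hausdorff_dim_ge0 _)).
apply/(hausdorff_dim_leP _ (hausdorff_dim_ge0 _)).
have [g [cg ig g0 g1 gE]] := arc.
apply: (@null_above_cut_points _ gamma); first exact: hausdorff_dim_ge0.
- split => //.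
    rewrite gE; apply: connected_continuous_connected => //.
    exact: segment_connected.
  by apply/(hausdorff_dim_leP _ (hausdorff_dim_ge0 _)).
- by rewrite gE; exists 0 => //=; rewrite in_itv/= lexx ler01.
- by rewrite gE; exists 1 => //=; rewrite in_itv/= lexx ler01.
Qed.

End StarSystem.

(** * Geometry of admissible parameters *)

(* Applied with [D] the triangle, to confine an attractor, and with [D] an
   attractor, to show that it contains smaller self-similar sets. *)
Lemma self_similar_sub (R : realType) (J : Type) (f : J -> R * R -> R * R) (r : R)
    (L D : set (R * R)) :
  0 <= r < 1 ->
  (forall j x y, eucl_dist (f j x) (f j y) <= r * eucl_dist x y) ->
  compact L -> (forall x, L x -> exists j, exists2 z, L z & x = f j z) ->
  closed D -> D !=set0 -> (forall j x, D x -> D (f j x)) ->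
  L `<=` D.
Proof.
move=> /andP[r0 r1] fr cL Lf cD [d Dd] Df.
have [M M0 LM] := compact_eucl_bounded (compactU cL (@compact_set1 _ d)).
have near_D n x : L x -> exists2 y, D y & eucl_dist x y <= r ^+ n * M.
  elim: n x => [|n IH] x Lx.
    by exists d => //; rewrite expr0 mul1r; apply: LM; [left|right].
  have [j [z Lz ->]] := Lf _ Lx; have [y Dy zy] := IH z Lz.
  exists (f j y); first exact: Df.
  by apply: (le_trans (fr _ _ _)); rewrite exprS -mulrA ler_wpM2l.
move=> x Lx; rewrite (closure_id D).1//; apply: closure_eucl => e e0.
have [|n h] := @geometric_lt _ r M e _ e0; first by rewrite r0.
have [y Dy xy] := near_D n x Lx; exists y => //.
exact: le_lt_trans xy h.
Qed.

Definition tri (T : Type) (x y z : T) (k : 'I_3) : T :=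
  match val k with 0 => x | 1 => y | _ => z end.

(** * Barycentric coordinates *)

Section Barycentric.
Variable R : realType.
Implicit Types (x y z : R * R) (a b k : 'I_3).

Let s3 : R := Num.sqrt 3.

Lemma s3_gt0 : 0 < s3. Proof. by rewrite sqrtr_gt0. Qed.
Lemma s3_sqr : s3 ^+ 2 = 3. Proof. by rewrite sqr_sqrtr. Qed.
Lemma s3_neq0 : s3 != 0. Proof. by rewrite gt_eqF// s3_gt0. Qed.

Definition vertex : 'I_3 -> R * R := tri A1 A2 A3.

Definition bary k z : R :=
  tri (1 - z.1 - z.2 / s3) (z.1 - z.2 / s3) (2 * z.2 / s3) k.

Definition triangle : set (R * R) := [set z | forall k, 0 <= bary k z].

Lemma bary_sum z : bary 0 z + bary 1 z + bary 2 z = 1.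
Proof. by rewrite /bary /tri /=; lra. Qed.

Lemma bary_inj x y : (forall k, bary k x = bary k y) -> x = y.
Proof.
move=> xy; have := xy 1; have := xy 2; rewrite /bary /tri /= => h2 h1.
have e2 : x.2 = y.2.
  have s0 := s3_neq0; apply: (mulfI (x := 2 / s3)); first by rewrite mulf_neq0 ?invr_eq0.
  by rewrite mulrAC h2 mulrAC.
have e1 : x.1 = y.1 by move: h1; rewrite e2; lra.
by rewrite [x]surjective_pairing [y]surjective_pairing e1 e2.
Qed.

Lemma bary_vertex k a : bary k (vertex a) = (k == a)%:R.
Proof.
have s0 := s3_neq0.
case: k => -[|[|[|//]]] k3; case: a => -[|[|[|//]]] a3;
  rewrite -val_eqE /bary /vertex /tri /A1 /A2 /A3 /= -/s3 ?mulr1n ?mulr0n; by field.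
Qed.

Lemma bary_linear k t x y :
  bary k (t *: x - t *: y + y) = t * bary k x + (1 - t) * bary k y.
Proof.
have e1 : (t *: x - t *: y + y).1 = t * x.1 - t * y.1 + y.1 by [].
have e2 : (t *: x - t *: y + y).2 = t * x.2 - t * y.2 + y.2 by [].
by have s0 := s3_neq0; case: k => -[|[|[|//]]] k3; rewrite /bary /tri e1 e2 /=; field.
Qed.

Lemma eucl_dist_sqr x y :
  eucl_dist x y ^+ 2 = (x.1 - y.1) ^+ 2 + (x.2 - y.2) ^+ 2.
Proof. by rewrite sqr_sqrtr// addr_ge0 ?sqr_ge0. Qed.

(** The triangle has unit sides and the third coordinate difference is [- u - v]; eliminating it
    leaves this quadratic form. *)
Lemma eucl_dist_bary x y (u := bary 0 x - bary 0 y) (v := bary 1 x - bary 1 y) :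
  eucl_dist x y ^+ 2 = u ^+ 2 + u * v + v ^+ 2.
Proof.
rewrite eucl_dist_sqr /u /v /bary /tri /=.
have := s3_sqr; have := s3_neq0; set s := s3 => s0 s2.
have e : 1 = 3 / s ^+ 2 :> R by rewrite s2; field.
by rewrite -[X in _ + X = _]mul1r e; field.
Qed.

Lemma closed_triangle : closed triangle.
Proof.
have cb k : continuous (bary k).
  move=> z; have c1 : (fun z : R * R => z.1) @ z --> z.1 by exact: cvg_fst.
  have c2 : (fun z : R * R => z.2) @ z --> z.2 by exact: cvg_snd.
  rewrite /bary; case: k => -[|[|[|//]]] k3; rewrite /tri /=.
  - by apply: cvgB; [apply: cvgB => //; exact: cvg_cst|apply: cvgM => //; exact: cvg_cst].
  - by apply: cvgB => //; apply: cvgM => //; exact: cvg_cst.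
  - by apply: cvgM; [apply: cvgM => //; exact: cvg_cst|exact: cvg_cst].
have -> : triangle = \bigcap_k (bary k @^-1` [set t | 0 <= t]).
  by apply/seteqP; split=> z h k; [move=> _; exact: h|exact: (h k I)].
apply: closed_bigI => k _; apply: closed_comp; last exact: closed_ge.
by move=> z _; exact: cb.
Qed.

Lemma triangle_vertex a : triangle (vertex a).
Proof. by move=> k; rewrite bary_vertex. Qed.

(* Trilateration: [S0 z] is determined by its distances to the three
   non-collinear points [S0 A1], [S0 A2], [S0 A3], so [S0] is affine. *)
Lemma similarity_bary (S0 : R * R -> R * R) (r : R) : 0 < r ->
  (forall x y, eucl_dist (S0 x) (S0 y) = r * eucl_dist x y) ->
  forall k z, bary k (S0 z) = bary 0 z * bary k (S0 A1)
    + bary 1 z * bary k (S0 A2) + bary 2 z * bary k (S0 A3).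
Proof.
move=> r0 Sr k z.
have Q x y : ((S0 x).1 - (S0 y).1) ^+ 2 + ((S0 x).2 - (S0 y).2) ^+ 2 =
    r ^+ 2 * ((x.1 - y.1) ^+ 2 + (x.2 - y.2) ^+ 2).
  by rewrite -!eucl_dist_sqr Sr exprMn.
have := Q z A1; have := Q z A2; have := Q z A3.
have := Q A2 A1; have := Q A3 A1; have := Q A3 A2.
move: (S0 z) (S0 A1) (S0 A2) (S0 A3) => [w1 w2] [b1 b2] [e1 e2] [f1 f2].
rewrite /A1 /A2 /A3 /= -/s3.
case: z => x y; rewrite /bary /tri /=.
have := s3_sqr; have := s3_neq0; set s := s3; clearbody s => s0 s2.
have [u ->] : exists u : R, y = s * u by exists (y / s); field.
have E1 : (s / 2 - 0) ^+ 2 = 3 / 4 by rewrite -s2; field.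
have E2 : (s * u - s / 2) ^+ 2 = 3 * (u - 1 / 2) ^+ 2 by rewrite -s2; field.
have E3 : (s * u - 0) ^+ 2 = 3 * u ^+ 2 by rewrite -s2; field.
rewrite E1 E2 E3 => q32 q31 q21 q3 q2 q1.
(* [(d1, d2)] is the defect of the affine formula, where [x - u] and [2 * u] are two barycentric
   coordinates of [z]. The distance equations make it orthogonal to two edges of the image
   triangle. *)
pose d1 := w1 - b1 - (x - u) * (e1 - b1) - 2 * u * (f1 - b1).
pose d2 := w2 - b2 - (x - u) * (e2 - b2) - 2 * u * (f2 - b2).
have ee : (e1 - b1) ^+ 2 + (e2 - b2) ^+ 2 = r ^+ 2 by lra.
have ff : (f1 - b1) ^+ 2 + (f2 - b2) ^+ 2 = r ^+ 2 by lra.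
have ef : (e1 - b1) * (f1 - b1) + (e2 - b2) * (f2 - b2) = r ^+ 2 / 2 by lra.
have we : (w1 - b1) * (e1 - b1) + (w2 - b2) * (e2 - b2) = r ^+ 2 * x by lra.
have wf : (w1 - b1) * (f1 - b1) + (w2 - b2) * (f2 - b2) = r ^+ 2 * (x + 3 * u) / 2.
  by lra.
have de : d1 * (e1 - b1) + d2 * (e2 - b2) = 0.
  transitivity (r ^+ 2 * x - (x - u) * r ^+ 2 - 2 * u * (r ^+ 2 / 2)); last by field.
  by rewrite -ef -we -ee /d1 /d2; ring.
have df : d1 * (f1 - b1) + d2 * (f2 - b2) = 0.
  transitivity (r ^+ 2 * (x + 3 * u) / 2 - (x - u) * (r ^+ 2 / 2) - 2 * u * r ^+ 2).
    by rewrite -wf -ef -ff /d1 /d2; ring.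
  by field.
(* The determinant of these edges; its square is their Gram determinant [3 / 4 * r ^+ 4]. *)
pose D := (e1 - b1) * (f2 - b2) - (e2 - b2) * (f1 - b1).
have D0 : D != 0.
  rewrite -sqrf_eq0; suff -> : D ^+ 2 = r ^+ 2 * r ^+ 2 - (r ^+ 2 / 2) ^+ 2.
    have -> : r ^+ 2 * r ^+ 2 - (r ^+ 2 / 2) ^+ 2 = 3 / 4 * r ^+ 4 by field.
    by rewrite mulf_neq0 ?expf_neq0 ?gt_eqF// divr_gt0.
  by rewrite -ef -{1}ee -ff /D; ring.
have d10 : d1 = 0.
  apply: (mulIf D0); rewrite mul0r.
  transitivity (0 * (f2 - b2) - 0 * (e2 - b2)); last by rewrite !mul0r subrr.
  by rewrite -{1}de -df /D; ring.
have d20 : d2 = 0.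
  apply: (mulIf D0); rewrite mul0r.
  transitivity (0 * (e1 - b1) - 0 * (f1 - b1)); last by rewrite !mul0r subrr.
  by rewrite -{1}df -de /D; ring.
have -> : w1 = b1 + (x - u) * (e1 - b1) + 2 * u * (f1 - b1).
  by move: d10; rewrite /d1; lra.
have -> : w2 = b2 + (x - u) * (e2 - b2) + 2 * u * (f2 - b2).
  by move: d20; rewrite /d2; lra.
by case: k => -[|[|[|//]]] k3 /=; field.
Qed.
End Barycentric.

Lemma ord3_ind (P : 'I_3 -> Prop) : P 0 -> P 1 -> P 2 -> forall k, P k.
Proof.
move=> P0 P1 P2 [[|[|[|//]]] h].
- by rewrite (_ : Ordinal h = 0)//; exact: val_inj.
- by rewrite (_ : Ordinal h = 1)//; exact: val_inj.
- by rewrite (_ : Ordinal h = 2)//; exact: val_inj.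
Qed.

(** * The star structure of admissible systems *)

Section Admissible.
Variable R : realType.
Implicit Types (x y z : R * R) (a b k : 'I_3).

Definition corner (t : R) a z : R * R := t *: z - t *: vertex R a + vertex R a.

Lemma bary_corner t a k z :
  bary k (corner t a z) = t * bary k z + (1 - t) * (k == a)%:R.
Proof. by rewrite bary_linear bary_vertex. Qed.

Lemma corner_dist t a x y : 0 < t ->
  eucl_dist (corner t a x) (corner t a y) = t * eucl_dist x y.
Proof.
move=> t0; rewrite /eucl_dist -{5}(gtr0_norm t0) -sqrtr_sqr -sqrtrM ?sqr_ge0//.
have e1 u : (corner t a u).1 = t * u.1 - t * (vertex R a).1 + (vertex R a).1 by [].
have e2 u : (corner t a u).2 = t * u.2 - t * (vertex R a).2 + (vertex R a).2 by [].
by congr Num.sqrt; rewrite !e1 !e2; ring.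
Qed.

Lemma triangle_corner t a z : 0 < t < 1 -> triangle z -> triangle (corner t a z).
Proof.
move=> /andP[t0 t1] tz k; rewrite bary_corner addr_ge0 ?mulr_ge0 ?tz ?(ltW t0)//.
by rewrite subr_ge0 ltW.
Qed.

Lemma bary_corner_ge t a z : 0 < t -> triangle z -> 1 - t <= bary a (corner t a z).
Proof.
by move=> t0 tz; rewrite bary_corner eqxx mulr1 lerDr mulr_ge0 ?tz// ltW.
Qed.

Lemma bary_pair_le1 a b z : a != b -> triangle z -> bary a z + bary b z <= 1.
Proof.
move=> ab tz; have := bary_sum z; have := tz 0; have := tz 1; have := tz 2.
by elim/ord3_ind: a ab; elim/ord3_ind: b => // _; lra.
Qed.

Variables (p : 'I_3 -> R) (B q : 'I_3 -> R * R) (S0 : R * R -> R * R) (rho0 : R).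
Variables (K K' : set (R * R)) (O : R * R).
Hypotheses (p_gt0 : forall a, 0 < p a) (p_lt1 : p 0 + p 1 + p 2 < 1).
Let f (i : option 'I_3) : R * R -> R * R :=
  if i is Some a then corner (p a) a else S0.
Hypotheses (cK' : compact K')
  (K'split : forall x, K' x -> exists a, exists2 z, K' z & x = corner (p a) a z).
Hypotheses (Tq : forall a, triangle (q a)) (q0 : forall a, bary a (q a) = 0).
Hypothesis BE : forall a, B a = corner (p a) a (corner (p (a + 1)) (a + 1) (q a)).
Hypothesis K'B : forall a, K' (B a).
Hypotheses (rho0_gt0 : 0 < rho0)
  (S0E : forall x y, eucl_dist (S0 x) (S0 y) = rho0 * eucl_dist x y)
  (S0V : forall a, S0 (vertex R a) = B a).
Hypotheses (K0 : K !=set0) (cK : compact K) (KE : K = \bigcup_i (f i @` K)).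
Hypothesis S0O : S0 O = O.

Lemma p_pair a b : a != b -> p a + p b < 1.
Proof.
have := p_gt0 0; have := p_gt0 1; have := p_gt0 2.
by elim/ord3_ind: a; elim/ord3_ind: b => // h2 h1 h0 _; move: p_lt1; lra.
Qed.

Lemma succ3_neq a : a + 1 != a.
Proof. by case: a => -[|[|[|]]]. Qed.

Lemma p_range a : 0 < p a < 1.
Proof.
by rewrite p_gt0/=; have := p_pair (succ3_neq a); have := p_gt0 (a + 1); lra.
Qed.

(** Two such coordinates of different index would add up to more than 1, as [p a + p b < 1]. *)
Lemma same_corner a b z : triangle z -> 1 - p a <= bary a z -> 1 - p b <= bary b z ->
  a = b.
Proof.
move=> tz za zb; apply/eqP; apply: contraT => ab.
by have := bary_pair_le1 ab tz; have := p_pair ab; lra.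
Qed.

Let cp a := corner (p (a + 1)) (a + 1) (q a).

Lemma triangle_cp a : triangle (cp a).
Proof. by apply: triangle_corner => //; exact: p_range. Qed.

Lemma triangle_B a : triangle (B a).
Proof. by rewrite BE; apply: triangle_corner (triangle_cp a); exact: p_range. Qed.

Lemma bary_B a : bary a (B a) = 1 - p a.
Proof.
have na : (a == a + 1) = false by rewrite eq_sym (negbTE (succ3_neq a)).
by rewrite BE !bary_corner q0 eqxx na !mulr0 add0r mulr0 add0r mulr1.
Qed.

Lemma bary_B_le a b : a != b -> bary a (B b) <= p b.
Proof.
move=> ab; have := bary_pair_le1 ab (@triangle_B b); rewrite bary_B; lra.
Qed.

Lemma p_max_lt1 : exists2 r, 0 <= r < 1 & forall a, p a <= r.
Proof.
exists (Num.max (p 0) (Num.max (p 1) (p 2))).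
  by rewrite le_max ltW//= !gt_max !(andP (p_range _)).2.
by elim/ord3_ind; rewrite !le_max lexx ?orbT.
Qed.

Lemma rho0_lt1 : rho0 < 1.
Proof.
have d01 : eucl_dist (vertex R 0) (vertex R 1) = 1.
  by rewrite /eucl_dist /vertex /tri /= !subrr expr0n/= addr0 sub0r sqrrN expr1n sqrtr1.
have := S0E (vertex R 0) (vertex R 1); rewrite d01 mulr1 !S0V => rE.
rewrite -rE -(@ltr_pXn2r _ 2) ?nnegrE ?eucl_dist_ge0 ?ler01// expr1n.
rewrite eucl_dist_bary !bary_B.
(* The two coordinate differences have opposite signs and absolute values below 1, so the quadratic
   form stays below 1. *)
have := @bary_B_le 0 1 isT; have := @bary_B_le 1 0 isT.
have := @triangle_B 0 1; have := @triangle_B 1 0.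
have := @p_pair 0 1 isT; have := p_gt0 0; have := p_gt0 1.
move: (bary 1 (B 0)) (bary 0 (B 1)) (p 0) (p 1) => u v s t; nra.
Qed.

Lemma f_contract : exists2 r, 0 <= r < 1 & exists rho : option 'I_3 -> R,
  [/\ forall i, 0 < rho i, forall i, rho i <= r &
      forall i x y, eucl_dist (f i x) (f i y) = rho i * eucl_dist x y].
Proof.
have [r /andP[r0 r1] pr] := p_max_lt1.
exists (Num.max r rho0); first by rewrite le_max r0 gt_max r1 rho0_lt1.
exists (fun i => if i is Some a then p a else rho0); split.
- by case.
- by case=> [a|]; rewrite le_max ?pr ?lexx ?orbT.
- by case=> [a|] x y //=; rewrite corner_dist.
Qed.

Lemma bary_S0 k z : bary k (S0 z) =
  bary 0 z * bary k (B 0) + bary 1 z * bary k (B 1) + bary 2 z * bary k (B 2).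
Proof. by rewrite (similarity_bary rho0_gt0 S0E) -!S0V. Qed.

Lemma triangle_f i z : triangle z -> triangle (f i z).
Proof.
case: i => [a|] tz /=; first by apply: triangle_corner => //; exact: p_range.
by move=> k; rewrite bary_S0 !addr_ge0// mulr_ge0 ?tz//; exact: triangle_B.
Qed.

Lemma Kf i z : K z -> K (f i z).
Proof. by move=> Kz; rewrite KE; exists i => //; exists z. Qed.

Lemma sub_K_of_backward (J : Type) (g : J -> option 'I_3) (L : set (R * R)) :
  compact L -> (forall x, L x -> exists j, exists2 z, L z & x = f (g j) z) ->
  L `<=` K.
Proof.
move=> cL Lg; have [r r01 [rho [rho_gt0 rho_r rhoE]]] := f_contract.
apply: (@self_similar_sub R J (f \o g) r) => //=.
- by move=> j x y; rewrite rhoE ler_wpM2r ?eucl_dist_ge0.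
- exact: compact_closed (@norm_hausdorff _ _) cK.
- by move=> j x; exact: Kf.
Qed.

Lemma sub_triangle (L : set (R * R)) :
  compact L -> (forall x, L x -> exists i, exists2 z, L z & x = f i z) ->
  L `<=` @triangle R.
Proof.
move=> cL Lf; have [r r01 [rho [rho_gt0 rho_r rhoE]]] := f_contract.
apply: (@self_similar_sub R _ f r) => //.
- by move=> j x y; rewrite rhoE ler_wpM2r ?eucl_dist_ge0.
- exact: closed_triangle.
- by exists (vertex R 0); exact: triangle_vertex.
- by move=> j x; exact: triangle_f.
Qed.

Lemma K_triangle : K `<=` @triangle R.
Proof.
by apply: sub_triangle => // x; rewrite {1}KE => -[i _ [z Kz <-]]; exists i, z.
Qed.

Lemma K'_triangle : K' `<=` @triangle R.
Proof.
by apply: sub_triangle => // x /K'split[a [z K'z ->]]; exists (Some a), z.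
Qed.

Lemma K'_sub_K : K' `<=` K.
Proof.
apply: (@sub_K_of_backward _ Some) => // x; exact: K'split.
Qed.

Lemma K_fixpoint i x : f i x = x -> K x.
Proof.
move=> fx; apply: (@sub_K_of_backward unit (fun=> i) [set x]) => //.
  exact: compact_set1.
by move=> _ ->; exists tt, x.
Qed.

Lemma corner_vertex t a : corner t a (vertex R a) = vertex R a.
Proof. by rewrite /corner subrr add0r. Qed.

Lemma corner_inj a : injective (corner (p a) a).
Proof.
move=> x y xy; apply: eucl_dist_eq0.
by rewrite -(ler_pM2l (p_gt0 a)) -(corner_dist a)// xy eucl_dist_xx mulr0.
Qed.

(** The coordinate of index [a] shows that [B a] can only come from the corner map [a] of [K'];
    injectivity then identifies its preimage as [cp a]. *)
Lemma K'_cp a : K' (cp a).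
Proof.
have [b [z K'z Bz]] := K'split (K'B a).
have ab : a = b.
  apply: (@same_corner _ _ (B a)); first exact: triangle_B.
    by rewrite bary_B.
  by rewrite Bz; apply: bary_corner_ge => //; exact: K'_triangle.
by move: Bz; rewrite -{b}ab BE => /corner_inj; rewrite -/(cp a) => ->.
Qed.

Lemma cp_cell a : (f (Some (a + 1)) @` K) (cp a).
Proof.
have [b [z K'z cz]] := K'split (K'_cp a).
have ab : a + 1 = b.
  apply: (@same_corner _ _ (cp a)); first exact: triangle_cp.
    by apply: bary_corner_ge.
  by rewrite cz; apply: bary_corner_ge => //; exact: K'_triangle.
by exists z; [exact: K'_sub_K|rewrite cz ab].
Qed.

(** The coordinate of [S0 y] of index [a] is the average of those of the [B b] with weights
    [bary b y]. These are at most [1 - p a], with equality only for [b = a], so all the weight sits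
    on [a]. *)
Lemma core_meets_corner a y z : K y -> K z -> S0 y = corner (p a) a z -> y = vertex R a.
Proof.
move=> Ky Kz yz; have ty := K_triangle Ky.
have := @bary_corner_ge (p a) a z (p_gt0 a) (K_triangle Kz).
rewrite -yz bary_S0.
have ge0 b : 0 <= bary b y * (1 - p a - bary a (B b)).
  apply: mulr_ge0 => //; have [<-|ab] := eqVneq a b; first by rewrite bary_B subrr.
  by have := bary_B_le ab; have := p_pair ab; lra.
have pos b : b != a -> 0 < 1 - p a - bary a (B b).
  by rewrite eq_sym => ab; have := bary_B_le ab; have := p_pair ab; lra.
have s1 := bary_sum y => le.
have all0 b : bary b y * (1 - p a - bary a (B b)) = 0.
  have h0 := ge0 0; have h1 := ge0 1; have h2 := ge0 2.
  have : bary 0 y * (1 - p a - bary a (B 0)) + bary 1 y * (1 - p a - bary a (B 1))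
     + bary 2 y * (1 - p a - bary a (B 2)) <= 0.
    have -> : bary 0 y = 1 - bary 1 y - bary 2 y by move: s1; lra.
    move: le; have -> : bary 0 y = 1 - bary 1 y - bary 2 y by move: s1; lra.
    lra.
  by elim/ord3_ind: b; lra.
have z0 b : b != a -> bary b y = 0.
  by move=> ba; have /eqP := all0 b; rewrite mulf_eq0 (gt_eqF (pos b ba)) orbF => /eqP.
apply: bary_inj => k; rewrite bary_vertex.
have [->|ka] := eqVneq k a; last by rewrite z0.
rewrite mulr1n -s1; move: (z0 0) (z0 1) (z0 2).
elim/ord3_ind: (a) => h0 h1 h2.
- by rewrite h1// h2// !addr0.
- by rewrite h0// h2// add0r addr0.
- by rewrite h0// h1// !add0r.
Qed.

Lemma admissible_cut_points_dim (gamma : set (R * R)) :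
  is_arc gamma O (vertex R 0) -> gamma `<=` K ->
  hausdorff_dim (cut_points K) = hausdorff_dim gamma.
Proof.
have [r /andP[r0 r1] [rho [rho_gt0 rho_r rhoE]]] := f_contract.
apply: (@star_cut_points_dim R K f rho r (@vertex R) cp O) => //.
- by apply: (@K_fixpoint None).
- by move=> a; apply: (@K_fixpoint (Some a)); exact: corner_vertex.
- by move=> a; exact: corner_vertex.
- by move=> a; rewrite /= S0V BE.
- exact: cp_cell.
- by move=> a y z Ky Kz /(core_meets_corner Ky Kz)->.
- move=> a b y z Ky Kz yz; apply: (@same_corner _ _ (f (Some a) y)).
  + by apply: triangle_f; exact: K_triangle.
  + by apply: bary_corner_ge => //; exact: K_triangle.
  + by rewrite yz; apply: bary_corner_ge => //; exact: K_triangle.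
Qed.

End Admissible.

(** * Return to the given maps and sides *)

Lemma S1_corner (R : realType) (p : R) z : S1 p z = corner p 0 z.
Proof.
have A0 : vertex R 0 = 0 by [].
by rewrite /corner A0 scaler0 subr0 addr0.
Qed.

Lemma side_bary (R : realType) (a b k : 'I_3) (z : R * R) : k != a -> k != b ->
  side (vertex R a) (vertex R b) z -> triangle z /\ bary k z = 0.
Proof.
move=> ka kb [t /=]; rewrite in_itv/= => /andP[t0 t1] <-.
have lin j : bary j ((1 - t) *: vertex R a + t *: vertex R b) =
    (1 - t) * (j == a)%:R + t * (j == b)%:R.
  rewrite -!bary_vertex.
  have -> : (1 - t) *: vertex R a + t *: vertex R b =
      t *: vertex R b - t *: vertex R a + vertex R a.
    by rewrite scalerBl scale1r addrC -addrA [vertex R a - _]addrC.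
  by rewrite bary_linear addrC.
split=> [j|]; rewrite lin; last by rewrite (negbTE ka) (negbTE kb) !mulr0 addr0.
by rewrite addr_ge0// mulr_ge0// subr_ge0.
Qed.

Theorem theorem2 (R : realType) (p1 p2 p3 : R) (B1 B2 B3 : R * R)
    (S0 : R * R -> R * R) (K : set (R * R)) (O : R * R)
    (gamma1 : set (R * R))
    (hadm : admissible p1 p2 p3 B1 B2 B3)
    (hS0 : is_similarity S0)
    (hS0A : [/\ S0 A1 = B1, S0 A2 = B2 & S0 A3 = B3])
    (hK : is_attractor [set S0; S1 p1; S2 p2; S3 p3] K)
    (hO : S0 O = O)
    (hgamma1 : is_arc gamma1 O A1)
    (hgamma1K : gamma1 `<=` K) :
  hausdorff_dim (cut_points K) = hausdorff_dim gamma1.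
Proof.
have [[p1_gt0 p2_gt0 p3_gt0 p_lt1] [_ [K' [_ cK' K'E]]]] := hadm.
move=> [[K'B1 [q1 sq1 Bq1]] [K'B2 [q2 sq2 Bq2]] [K'B3 [q3 sq3 Bq3]]].
have [S01 S02 S03] := hS0A; have [rho rho_gt0 S0E] := hS0.
have [K0 cK KE] := hK.
(* Each of these points lies on the side opposite to the vertex fixed by the outer map of the
   composition. *)
have [Tq1 q10] : triangle q1 /\ bary 0 q1 = 0 by exact: (@side_bary R 1 2).
have [Tq2 q20] : triangle q2 /\ bary 1 q2 = 0 by exact: (@side_bary R 0 2).
have [Tq3 q30] : triangle q3 /\ bary 2 q3 = 0 by exact: (@side_bary R 0 1).
apply: (@admissible_cut_points_dim R (tri p1 p2 p3) (tri B1 B2 B3) (tri q1 q2 q3)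
  S0 rho K K' O) => //.
- by elim/ord3_ind.
- move=> x; rewrite {1}K'E => -[_ /= [[->|->]|->] [z K'z <-]].
  + by exists 0, z; rewrite ?S1_corner.
  + by exists 1, z.
  + by exists 2, z.
- by elim/ord3_ind.
- by elim/ord3_ind.
- elim/ord3_ind.
  + by rewrite -[LHS]Bq1 /= S1_corner.
  + by rewrite -[LHS]Bq2.
  + by rewrite -[LHS]Bq3 /= S1_corner.
- by elim/ord3_ind.
- by elim/ord3_ind.
- rewrite {1}KE; apply/seteqP; split => x.
  + move=> [_ /= [[[->|->]|->]|->] [z Kz <-]].
    * by exists None => //; exists z.
    * by exists (Some 0) => //; exists z => //; rewrite S1_corner.
    * by exists (Some 1) => //; exists z.
    * by exists (Some 2) => //; exists z.
  + move=> [[a|] _ [z Kz <-]]; last by exists S0; [do 3 left|exists z].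
    elim/ord3_ind: a.
    * by exists (S1 p1); [left; left; right|exists z => //; rewrite S1_corner].
    * by exists (S2 p2); [left; right|exists z].
    * by exists (S3 p3); [right|exists z].
Qed.
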